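(* For every integer $m\ge 0$, the shuffle poset $\mathcal{W}_{m,1}$ has characteristic polynomial $$\chi(\mathcal{W}_{m,1},t)=(t-1)^m(t-m-1).$$
   Context: All words consist of distinct letters; a word is also used to denote its set of letters. For words $\mathbf{u},\mathbf{v}$, the restriction $\mathbf{u}_{\mathbf{v}}$ is the subword of $\mathbf{u}$ whose letters are exactly those of $\mathbf{u}\cap\mathbf{v}$. A shuffle of words $\mathbf{u},\mathbf{v}$ with no common letter is a word $\mathbf{s}$ with letter set $\mathbf{u}\uplus\mathbf{v}$, $\mathbf{s}_{\mathbf{u}}=\mathbf{u}$ and $\mathbf{s}_{\mathbf{v}}=\mathbf{v}$. Fix a word $\mathbf{x}$ of length $m$ and a disjoint word $\mathbf{y}$ of length $1$. The elements of $\mathcal{W}_{m,1}$ are all shuffles of a subword of $\mathbf{x}$ with a subword of $\mathbf{y}$. The order is: $\mathbf{v}\le\mathbf{w}$ if $\mathbf{v}_{\mathbf{x}}\supseteq\mathbf{w}_{\mathbf{x}}$, $\mathbf{v}_{\mathbf{y}}\subseteq\mathbf{w}_{\mathbf{y}}$ (as sets), and the common letters of $\mathbf{v}$ and $\mathbf{w}$ appear in the same order in both, i.e. $\mathbf{v}_{\mathbf{w}}=\mathbf{w}_{\mathbf{v}}$ (equivalently, $\mathbf{w}$ arises from $\mathbf{v}$ by deleting letters of $\mathbf{x}$ and inserting letters of $\mathbf{y}$). This is a lattice with $\hat 0=\mathbf{x}$ and $\hat 1=\mathbf{y}$. Characteristic polynomial: take a maximal chain $\mathbf{x}=z_0<z_1<\cdots<z_{m+1}=\mathbf{y}$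 in $\mathcal{W}_{m,1}$, where $z_1,\dots,z_m$ are obtained by deleting the letters of $\mathbf{x}$ one at a time in some order (so $z_m$ is the empty word). Let $A_i$ be the set of atoms $a$ with $a\le z_i$, $a\not\le z_{i-1}$. The generalized rank $\rho(w)$ is the number of indices $i$ such that $A_i$ contains an atom $\le w$, and $$\chi(\mathcal{W}_{m,1},t)=\sum_{w\in\mathcal{W}_{m,1}}\mu(\hat 0,w)\,t^{\,m+1-\rho(w)},$$ with $\mu$ the Möbius function of $\mathcal{W}_{m,1}$. *)

(* Defs.v *)
From HB Require Import structures.
From mathcomp Require Import all_boot all_order all_algebra.

Set Implicit Arguments.
Unset Strict Implicit.
Unset Printing Implicit Defensive.

Import Order.TTheory.

Section Poset.
Local Open Scope order_scope.
Context {d : Order.disp_t} {P : finTBPOrderType d}.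

Definition covers (u v : P) : bool := (u < v) && [forall w, ~~ (u < w < v)].

Definition atom (a : P) : bool := covers \bot a.

(* [n] only serves as fuel: see [mobiusE] for the defining recursion. *)
Fixpoint mobius_rec (n : nat) (u v : P) : int :=
  if u == v then 1%R else
  if n is n'.+1 then
    if u < v then (- \sum_(w : P | (u <= w < v)%O) mobius_rec n' u w)%R
    else 0%R
  else 0%R.

Definition mobius (u v : P) : int := mobius_rec #|P| u v.

(* Chains [z 0 < z 1 < ... < z n] are functions on [nat] of which only the
   values at [0], ..., [n] are relevant. *)
Definition maximal_chain (n : nat) (z : nat -> P) : Prop :=
  [/\ z 0%N = \bot, z n = \top & forall i, (i < n)%N -> covers (z i) (z i.+1)].

Definition atom_block (z : nat -> P) (i : nat) : {set P} :=
  [set a | [&& atom a, a <= z i & ~~ (a <= z i.-1)]].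

Definition gen_rank (n : nat) (z : nat -> P) (w : P) : nat :=
  (\sum_(1 <= i < n.+1 | [exists a in atom_block z i, (a <= w)%O]) 1)%N.

Definition char_poly_chain (n : nat) (z : nat -> P) : {poly int} :=
  (\sum_(w : P) mobius \bot w *: 'X^(n - gen_rank n z w))%R.

Lemma mobius_rec_fuel n m (u v : P) :
  (#|[set w : P | (u <= w < v)%O]| <= n)%N ->
  (#|[set w : P | (u <= w < v)%O]| <= m)%N ->
  mobius_rec n u v = mobius_rec m u v.
Proof.
have pos k (a b : P) : a < b ->
  (#|[set w : P | (a <= w < b)%O]| <= k)%N -> (0 < k)%N.
  move=> ab; apply: leq_trans; apply/card_gt0P; exists a.
  by rewrite inE lexx.
elim: n m v => [|n IH] [|m] v //=.
- move=> h _; case: eqP => // _; case: ifP => // uv.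
  by have := pos 0%N _ _ uv h.
- move=> _ h; case: eqP => // _; case: ifP => // uv.
  by have := pos 0%N _ _ uv h.
move=> hn hm; case: eqP => // _; case: ifP => // uv.
congr (- _)%R; apply: eq_bigr => w /andP[uw wv].
have lt : (#|[set t : P | (u <= t < w)%O]| <
           #|[set t : P | (u <= t < v)%O]|)%N.
  apply/proper_card/properP; split.
    by apply/subsetP => t; rewrite !inE => /andP[-> /lt_trans ->].
  by exists w; rewrite !inE ?uw ?wv // ltxx andbF.
by apply: IH; rewrite -ltnS; apply: leq_trans lt _.
Qed.

Lemma mobiusE (u v : P) :
  mobius u v =
    if u == v then 1%R else
    if u < v then (- \sum_(w : P | (u <= w < v)%O) mobius u w)%R else 0%R.
Proof.
have card (b : P) : (#|[set t : P | (u <= t < b)%O]| < #|P|)%N.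
  rewrite -cardsT; apply/proper_card/properP; split; first exact: subsetT.
  by exists b; rewrite !inE // ltxx andbF.
rewrite /mobius (@mobius_rec_fuel _ #|P|.+1) //=; try exact: ltnW.
exact: ltnW (leqW (card v)).
Qed.

End Poset.

Section Words.
Context {T : choiceType}.
Implicit Types u v w x y : seq T.

Definition restr u v : seq T := [seq a <- u | a \in v].

Definition subwords u : seq (seq T) := [seq mask b u | b : (size u).-tuple bool].

Definition shuffles u v : seq (seq T) :=
  [seq s <- permutations (u ++ v) | (restr s u == u) && (restr s v == v)].

Definition shuffle_words x y : seq (seq T) :=
  flatten [seq shuffles u v | u <- subwords x, v <- subwords y].

Definition shuffle_le x y v w : bool :=
  [&& all (mem (restr v x)) (restr w x),
      all (mem (restr w y)) (restr v y)
    & restr v w == restr w v].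

Lemma mem_subwords u w : (w \in subwords u) = subseq w u.
Proof.
apply/imageP/subseqP => [[b _ ->]|[b sb ->]].
  by exists b; rewrite ?size_tuple.
by have /eqP sb' := sb; exists (Tuple (introT eqP sb)).
Qed.

Lemma mem_shuffles u v s :
  (s \in shuffles u v) =
  [&& perm_eq s (u ++ v), restr s u == u & restr s v == v].
Proof. by rewrite mem_filter mem_permutations andbC. Qed.

Lemma mem_shuffle_words x y w :
  reflect (exists u v, [/\ subseq u x, subseq v y & w \in shuffles u v])
          (w \in shuffle_words x y).
Proof.
apply: (iffP flattenP) => [[s /allpairsP[[u v]] /= []]|[u [v [ux vy wuv]]]].
  by rewrite !mem_subwords => ux vy -> wuv; exists u, v.
by exists (shuffles u v) => //; apply: allpairs_f; rewrite mem_subwords.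
Qed.

Lemma mem_restr u v a : (a \in restr u v) = (a \in v) && (a \in u).
Proof. by rewrite mem_filter. Qed.

Lemma restr_comp u v w : {subset restr u w <= v} ->
  restr (restr u v) w = restr u w.
Proof.
move=> h; rewrite /restr -filter_predI; apply: eq_in_filter => a au /=.
by case aw: (a \in w) => //=; apply: h; rewrite mem_restr aw.
Qed.

Lemma shuffle_wordsP x y w : uniq (x ++ y) ->
  reflect [/\ uniq w, {subset w <= x ++ y},
              subseq (restr w x) x & subseq (restr w y) y]
          (w \in shuffle_words x y).
Proof.
rewrite cat_uniq => /and3P[ux xy uy].
have dis a : a \in x -> a \in y -> False.
  by move=> ax ay; case/hasP: xy; exists a.
apply: (iffP (mem_shuffle_words _ _ _)) => [[u [v [sx sy]]]|[uw sub sx sy]].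
  rewrite mem_shuffles => /and3P[p /eqP pu /eqP pv].
  have mx := mem_subseq sx; have my := mem_subseq sy.
  have Ew a : (a \in w) = (a \in u) || (a \in v).
    by rewrite (perm_mem p) mem_cat.
  have -> : restr w x = u.
    rewrite -[RHS]pu; apply: eq_in_filter => a; rewrite Ew => /orP[h|h].
      by rewrite h (mx _ h).
    apply/idP/idP => [ax|/mx //]; by case: (dis a ax (my _ h)).
  have -> : restr w y = v.
    rewrite -[RHS]pv; apply: eq_in_filter => a; rewrite Ew => /orP[h|h].
      apply/idP/idP => [ay|/my //]; by case: (dis a (mx _ h) ay).
    by rewrite h (my _ h).
  split=> //.
    rewrite (perm_uniq p) cat_uniq (subseq_uniq sx) // (subseq_uniq sy) //.
    rewrite andbT; apply/hasPn => a /my ay; apply/negP => /mx ax.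
    exact: dis ax ay.
  by move=> a; rewrite Ew mem_cat => /orP[/mx ->|/my ->] //; rewrite orbT.
exists (restr w x), (restr w y); split=> //; rewrite mem_shuffles.
have idr v : restr w (restr w v) = restr w v.
  by apply: eq_in_filter => a aw; rewrite mem_restr aw ?andbT.
rewrite !idr !eqxx !andbT perm_sym.
have -> : restr w y = [seq a <- w | predC (mem x) a].
  apply: eq_in_filter => a aw /=; have := sub a aw; rewrite mem_cat.
  case ax: (a \in x) => /=; last by [].
  by move=> _; apply/negP => ay; apply: dis ax ay.
by rewrite /restr perm_filterC.
Qed.

Lemma shuffle_le_refl x y : reflexive (shuffle_le x y).
Proof. by move=> w; rewrite /shuffle_le eqxx andbT; apply/andP; split; apply/allP. Qed.

Lemma shuffle_leP x y v w :
  reflect [/\ forall a, a \in x -> a \in w -> a \in v,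
              forall a, a \in y -> a \in v -> a \in w
            & restr v w = restr w v]
          (shuffle_le x y v w).
Proof.
apply: (iffP and3P) => [[/allP h1 /allP h2 /eqP h3]|[h1 h2 h3]]; split=> //.
- move=> a ax aw; have : a \in restr v x by apply: h1; rewrite mem_restr ax.
  by rewrite mem_restr => /andP[].
- move=> a ay av; have : a \in restr w y by apply: h2; rewrite mem_restr ay.
  by rewrite mem_restr => /andP[].
- apply/allP => a; rewrite mem_restr => /andP[ax aw].
  suff: a \in restr v x by []; by rewrite mem_restr ax h1.
- apply/allP => a; rewrite mem_restr => /andP[ay av].
  suff: a \in restr w y by []; by rewrite mem_restr ay h2.
by rewrite h3.
Qed.

Lemma shuffle_le_anti x y v w :
  {subset v <= x ++ y} -> {subset w <= x ++ y} ->
  shuffle_le x y v w -> shuffle_le x y w v ->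
  (forall a, a \in x -> a \in y -> False) -> v = w.
Proof.
move=> sv sw /shuffle_leP[h1 h2 h3] /shuffle_leP[k1 k2 _] dis.
have vw a : a \in v -> a \in w.
  by move=> av; have := sv a av; rewrite mem_cat => /orP[?|?]; [apply: k1|apply: h2].
have wv a : a \in w -> a \in v.
  by move=> aw; have := sw a aw; rewrite mem_cat => /orP[?|?]; [apply: h1|apply: k2].
move: h3; rewrite /restr.
by rewrite (all_filterP (introT allP vw)) (all_filterP (introT allP wv)).
Qed.

Lemma shuffle_le_trans x y u v w :
  {subset u <= x ++ y} -> {subset w <= x ++ y} ->
  shuffle_le x y u v -> shuffle_le x y v w -> shuffle_le x y u w.
Proof.
move=> su sw /shuffle_leP[h1 h2 h3] /shuffle_leP[k1 k2 k3].
apply/shuffle_leP; split.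
- by move=> a ax /(k1 a ax); apply: h1.
- by move=> a ay /(h2 a ay); apply: k2.
have uw a : a \in u -> a \in w -> a \in v.
  move=> au aw; have := su a au; rewrite mem_cat => /orP[ax|ay].
    exact: k1.
  exact: h2.
rewrite -(@restr_comp u v); last first.
  by move=> a; rewrite mem_restr => /andP[aw au]; apply: uw.
rewrite -(@restr_comp w v); last first.
  by move=> a; rewrite mem_restr => /andP[au aw]; apply: uw.
rewrite h3 -k3 /restr -!filter_predI; apply: eq_filter => a /=.
exact: andbC.
Qed.

End Words.

Fact shuffle_display : Order.disp_t. Proof. exact: (Order.Disp tt tt). Qed.

(* [uniq (x ++ y)] says that [x] and [y] are words with no common letter. *)
Definition shuffle_poset (T : choiceType) (x y : seq T)
  (xyU : uniq (x ++ y)) : predArgType := seq_sub (shuffle_words x y).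

Section ShufflePoset.
Context {T : choiceType} {x y : seq T} (xyU : uniq (x ++ y)).
Local Notation W := (shuffle_poset xyU).

HB.instance Definition _ := Finite.copy W (seq_sub (shuffle_words x y)).
HB.instance Definition _ := SubFinite.copy W (seq_sub (shuffle_words x y)).

Definition shuffle_poset_le (v w : W) : bool := shuffle_le x y (val v) (val w).

Lemma shuffle_poset_sub (w : W) : {subset val w <= x ++ y}.
Proof. by case: (shuffle_wordsP (val w) xyU (valP w)). Qed.

Lemma shuffle_poset_disjoint a : a \in x -> a \in y -> False.
Proof.
move=> ax ay; move: (xyU); rewrite cat_uniq => /and3P[_ /hasP[]] //.
by exists a.
Qed.

Fact shuffle_poset_le_refl : reflexive shuffle_poset_le.
Proof. by move=> w; apply: shuffle_le_refl. Qed.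

Fact shuffle_poset_le_anti : antisymmetric shuffle_poset_le.
Proof.
move=> v w /andP[vw wv]; apply: val_inj.
apply: (shuffle_le_anti (@shuffle_poset_sub v) (@shuffle_poset_sub w) vw wv).
exact: shuffle_poset_disjoint.
Qed.

Fact shuffle_poset_le_trans : transitive shuffle_poset_le.
Proof.
move=> v u w; apply: shuffle_le_trans; exact: shuffle_poset_sub.
Qed.

HB.instance Definition _ := Order.Le_isPOrder.Build shuffle_display W
  shuffle_poset_le_refl shuffle_poset_le_anti shuffle_poset_le_trans.

Lemma shuffle_poset_leE (v w : W) : (v <= w)%O = shuffle_le x y (val v) (val w).
Proof. by []. Qed.

Fact shuffle_bot_subproof : x \in shuffle_words x y.
Proof.
apply/(shuffle_wordsP _ xyU); split.
- by move: (xyU); rewrite cat_uniq => /and3P[].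
- by move=> a ax; rewrite mem_cat ax.
- exact: filter_subseq.
rewrite /restr (_ : [seq a <- x | a \in y] = [::]) ?sub0seq //.
rewrite -(filter_pred0 x); apply: eq_in_filter => a ax /=.
by apply/negP => /(shuffle_poset_disjoint ax).
Qed.

Fact shuffle_top_subproof : y \in shuffle_words x y.
Proof.
apply/(shuffle_wordsP _ xyU); split.
- by move: (xyU); rewrite cat_uniq => /and3P[].
- by move=> a ay; rewrite mem_cat ay orbT.
- rewrite /restr (_ : [seq a <- y | a \in x] = [::]) ?sub0seq //.
  rewrite -(filter_pred0 y); apply: eq_in_filter => a ay /=.
  by apply/negP => ax; apply: shuffle_poset_disjoint ax ay.
exact: filter_subseq.
Qed.

Definition shuffle_bot : W := SeqSub shuffle_bot_subproof.
Definition shuffle_top : W := SeqSub shuffle_top_subproof.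

Fact shuffle_le_bot (w : W) : (shuffle_bot <= w)%O.
Proof.
have [uw sw sx _] := shuffle_wordsP _ xyU (valP w).
rewrite shuffle_poset_leE; apply/shuffle_leP; split=> //=.
  by move=> a ay ax; case: (shuffle_poset_disjoint ax ay).
have ux : uniq x by move: (xyU); rewrite cat_uniq => /and3P[].
rewrite [RHS](subseq_uniqP ux sx) /restr; apply: eq_in_filter => a ax.
by rewrite mem_filter ax.
Qed.

Fact shuffle_le_top (w : W) : (w <= shuffle_top)%O.
Proof.
have [uw sw _ sy] := shuffle_wordsP _ xyU (valP w).
rewrite shuffle_poset_leE; apply/shuffle_leP; split=> //=.
  by move=> a ax ay; case: (shuffle_poset_disjoint ax ay).
have uy : uniq y by move: (xyU); rewrite cat_uniq => /and3P[].
rewrite [LHS](subseq_uniqP uy sy) /restr; apply: eq_in_filter => a ay.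
by rewrite mem_filter ay.
Qed.

HB.instance Definition _ := Order.hasBottom.Build shuffle_display W shuffle_le_bot.
HB.instance Definition _ := Order.hasTop.Build shuffle_display W shuffle_le_top.

(* The letters of [x] are deleted one by one, in an arbitrary order, so that
   [z (size x)] is empty; maximality forces [size y = 1]. *)
Definition deletion_chain (z : nat -> W) : Prop :=
  maximal_chain (size x).+1 z /\
  forall i, (i < size x)%N ->
    exists2 a, a \in val (z i) & val (z i.+1) = rem a (val (z i)).

Lemma shuffle_lt_mem (v w : W) : (v < w)%O -> val v =i val w -> False.
Proof.
move=> vw e; suff wv : (w <= v)%O by have := le_lt_trans wv vw; rewrite ltxx.
move: (ltW vw); rewrite !shuffle_poset_leE => /shuffle_leP[_ _ h].
by apply/shuffle_leP; split=> // a _; rewrite e.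
Qed.

Lemma shuffle_coversP (v w : W) : (v <= w)%O -> ~ (val v =i val w) ->
  (forall t : W, (v <= t)%O -> (t <= w)%O ->
    val v =i val t \/ val t =i val w) -> covers v w.
Proof.
move=> vw ne h; rewrite /covers lt_neqAle vw andbT; apply/andP; split.
  by apply/eqP => e; apply: ne; rewrite e.
apply/forallP => t; apply/negP => /andP[vt tw].
case: (h t (ltW vt) (ltW tw)); exact: shuffle_lt_mem.
Qed.

Lemma deletion_chain_exists : size y = 1 -> exists z, deletion_chain z.
Proof.
move=> sy.
have [ux uy] : uniq x /\ uniq y.
  by move: (xyU); rewrite cat_uniq => /and3P[].
have dropW i : drop i x \in shuffle_words x y.
  apply/mem_shuffle_words; exists (drop i x), [::]; split.
  - by rewrite -{2}(cat_take_drop i x) suffix_subseq.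
  - exact: sub0seq.
  rewrite mem_shuffles cats0 perm_refl /restr filter_pred0 eqxx andbT.
  by apply/eqP/all_filterP/allP.
pose z i : W := if i <= size x then SeqSub (dropW i) else shuffle_top.
have dz i : i <= size x -> val (z i) = drop i x by rewrite /z => ->.
have zT : z (size x).+1 = \top%O by rewrite /z ltnn.
have ny i a : a \in drop i x -> a \in y -> False.
  by move=> /mem_drop; apply: shuffle_poset_disjoint.
exists z; split; last first.
  move=> i ix; rewrite !dz //; last exact: ltnW.
  case ex: x ix => [|a0 x0] // ix; rewrite -ex in ix *.
  exists (nth a0 x i); rewrite (drop_nth a0 ix) ?mem_head //=.
  by rewrite eqxx.
split=> //; first by apply: val_inj; rewrite dz // drop0.
move=> i; rewrite ltnS leq_eqVlt => /orP[/eqP ->|ix].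
  have z0 : val (z (size x)) = [::] by rewrite dz // drop_size.
  rewrite zT; apply: shuffle_coversP; first exact: lex1.
    by rewrite z0 /=; case: (y) sy => // b s _ /(_ b); rewrite mem_head.
  move=> t; rewrite shuffle_poset_leE z0 => /shuffle_leP[h1 _ _] _.
  have ty a : a \in val t -> a \in y.
    move=> at_; have := shuffle_poset_sub at_; rewrite mem_cat.
    by case/orP => // ax; have := h1 a ax at_.
  have [b Eb] : exists b, y = [:: b].
    by case: (y) sy => [|b []] // _; exists b.
  case bt: (b \in val t); [right|left] => a /=.
    apply/idP/idP => [/ty //|]; by rewrite {1}Eb inE => /eqP ->.
  rewrite in_nil; apply/esym/negP => at_; move: (ty a at_).
  by rewrite Eb inE => /eqP ea; rewrite -ea at_ in bt.
set v := z i; set w := z i.+1.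
have Ev : val v = drop i x by apply: dz; apply: ltnW.
have Ew : val w = drop i.+1 x by apply: dz.
have [a0 Ed] : exists a0, drop i x = a0 :: drop i.+1 x.
  case ex: x ix => [|b x0] // ix; rewrite -ex in ix *.
  by exists (nth b x i); rewrite (drop_nth b ix).
have ud : a0 \notin drop i.+1 x.
  by have := drop_uniq i ux; rewrite Ed /= => /andP[].
apply: shuffle_coversP.
- rewrite shuffle_poset_leE Ev Ew Ed; apply/shuffle_leP; split.
  + by move=> a _ aw; rewrite inE aw orbT.
  + by move=> a ay; rewrite -Ed => /ny /(_ ay).
  rewrite /restr /= (negPf ud); apply: eq_in_filter => a aw.
  by rewrite inE aw orbT.
- by rewrite Ev Ew Ed => /(_ a0); rewrite mem_head (negPf ud).
move=> t; rewrite !shuffle_poset_leE Ev Ew.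
move=> /shuffle_leP[h1 h2 _] /shuffle_leP[k1 k2 _].
have td a : a \in val t -> a \in drop i x.
  move=> at_; have := shuffle_poset_sub at_; rewrite mem_cat.
  by case/orP => [ax|ay]; [apply: h1|have /ny/(_ ay) := k2 a ay at_].
have dt a : a \in drop i.+1 x -> a \in val t.
  by move=> ad; apply: k1 => //; apply: mem_drop ad.
case a0t: (a0 \in val t); [left|right] => a.
  apply/idP/idP => [|/td //]; rewrite Ed inE => /predU1P[-> //|]; exact: dt.
apply/idP/idP => [at_|/dt //]; have := td a at_; rewrite Ed inE.
by case/predU1P => // ea; rewrite -ea at_ in a0t.
Qed.

End ShufflePoset.

(* Main.v *)
Require Import Defs.
From mathcomp Require Import all_boot all_order all_algebra.

Import Order.TTheory GRing.Theory.
Local Open Scope ring_scope.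

(** The proof sees the shuffle poset as a union of Boolean lattices, one above
    each full word, that is, each word [c] containing every letter of [x].
    Writing [y = b], the full words are [x] itself, which is the bottom, and
    the [m + 1] insertions of [b] into [x], where [m] is the length of [x].
    A word [v] is reached from a full word [c] by deleting letters of [x]
    exactly when [c <= v] and [c], [v] agree on containing [b]; such a [c] is
    called a completion of [v].  The words with a given completion [c]
    correspond to the subsets of the letters of [x] (those that are kept), so
    that summing a product of local weights over them gives a product of
    two-term sums ([sum_completed]).

    Give [x] the sign [1] and each insertion the sign [-1].  Then
      mu(0, w) = (sign of the letters missing from w) * (sum of the signs of
                 the completions of w)                     ([mobius_bot]).
    Indeed, let [f] be the right-hand side and sum [f] over the words below
    [w], grouping the terms by completion [c].  A full [c] which is not below
    [w] contributes nothing; one below [w] contributes its own sign times an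
    alternating sum over a Boolean interval, which vanishes unless [w] is full.
    When [w] is a full word other than [x], the full words below it are [x]
    and [w], and their signs cancel.

    For the generalized rank, [w] lies above an atom of one of the first [m]
    blocks of a deletion chain exactly when it misses the letter deleted at that
    step ([atom_block_letter]), and above an atom of the last block exactly when
    it contains [b] ([atom_block_last]).  Hence the exponent of the term of [w]
    is the number of letters of [x] in [w], plus one if [b] is not in [w]
    ([corankE]).

    Grouping the characteristic polynomial by completions, each full word gives
    a Boolean sum [(t - 1)^m] ([sum_completed_monomials]): the word [x]
    contributes it with the factor [t], each of the [m + 1] insertions with the
    factor [-1], and the total is [(t - 1)^m (t - (m + 1))]. *)

(** * Möbius functions and subsequences *)

Lemma mobius_unique {d : Order.disp_t} {P : finTBPOrderType d} (f : P -> int) :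
    f \bot%O = 1 ->
    (forall w, w != \bot%O -> \sum_(v : P | (v <= w)%O) f v = 0) ->
  forall w, mobius \bot%O w = f w.
Proof.
move=> f0 fS w; have [n] := ubnP #|[set v : P | (v < w)%O]|.
elim: n w => // n IH w hw; rewrite mobiusE.
have [<-|w0] := eqVneq; first by rewrite f0.
rewrite lt0x eq_sym w0.
have := fS w; rewrite eq_sym => /(_ w0).
rewrite (bigD1 w) //= => /eqP; rewrite addr_eq0 => /eqP ->.
congr (- _); apply: eq_big => [v|v]; first by rewrite le0x /= lt_neqAle andbC.
move=> /andP[_ vw]; apply: IH; rewrite ltnS in hw; apply: leq_trans hw.
apply/proper_card/properP; split.
  by apply/subsetP => t; rewrite !inE => /lt_trans; apply.
by exists v; rewrite inE ?ltxx.
Qed.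

Lemma subseq_catP (T : eqType) (u v s : seq T) : subseq (u ++ v) s ->
  exists s1 s2, [/\ s = s1 ++ s2, subseq u s1 & subseq v s2].
Proof.
elim: s u => [|a s IH] u.
  by case: u => //; case: v => // _; exists [::], [::].
case: u => [|c u] /=; first by move=> h; exists [::], (a :: s).
case: eqP => [->|ne] h.
  have [s1 [s2 [-> h1 h2]]] := IH u h.
  by exists (a :: s1), s2; split=> //=; rewrite eqxx.
have [s1 [s2 [-> h1 h2]]] := IH (c :: u) h.
by exists (a :: s1), s2; split=> //=; case: eqP.
Qed.

(** * Words with at most one letter outside x *)

Section OneLetter.

Context {T : choiceType} {x : seq T} {b : T} (xbU : uniq (x ++ [:: b])).
Local Notation W := (shuffle_poset xbU).
Local Notation L := (seq_sub x).
Implicit Types (v w c : W) (J : {set L}).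

Lemma uniq_x : uniq x. Proof. by move: xbU; rewrite cat_uniq => /andP[]. Qed.

Lemma b_notin_x : b \notin x.
Proof.
by apply/negP => bx; apply: (shuffle_poset_disjoint xbU bx); rewrite mem_head.
Qed.

Lemma mem_neq_b {a} : a \in x -> a != b.
Proof. by apply: contraTneq => ->; apply: b_notin_x. Qed.

Lemma uniq_word w : uniq (val w).
Proof. by case: (shuffle_wordsP _ xbU (valP w)). Qed.

Lemma subseq_word w : subseq (restr (val w) x) x.
Proof. by case: (shuffle_wordsP _ xbU (valP w)). Qed.

Lemma mem_word {w a} : a \in val w -> a \in x \/ a = b.
Proof.
move/(shuffle_poset_sub (w := w)); rewrite mem_cat inE.
by case/orP => [|/eqP]; [left | right].
Qed.

Lemma word_subproof s : uniq s -> {subset s <= x ++ [:: b]} ->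
  subseq (restr s x) x -> s \in shuffle_words x [:: b].
Proof.
move=> us ss sx; apply/(shuffle_wordsP _ xbU); split=> //.
rewrite /restr (eq_filter (a2 := pred1 b)); last by move=> a; rewrite inE.
have [bs|bs] := boolP (b \in s); first by rewrite filter_pred1_uniq ?subseq_refl.
rewrite (eq_in_filter (a2 := pred0)) ?filter_pred0 ?sub0seq // => a ain /=.
by apply: contraNF bs => /eqP <-.
Qed.

Lemma leWP v w :
  reflect [/\ {in x, forall a, a \in val w -> a \in val v},
              (b \in val v -> b \in val w)
            & restr (val v) (val w) = restr (val w) (val v)]
          (v <= w)%O.
Proof.
rewrite shuffle_poset_leE; apply: (iffP (shuffle_leP _ _ _ _)) => -[h1 h2 h3].
  by split=> //; apply: h2; rewrite mem_head.
by split=> // a; rewrite inE => /eqP ->.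
Qed.

(** Words agreeing on [b] are compared by deletion of letters alone. *)
Lemma le_subseq v w : (b \in val v) = (b \in val w) ->
  (v <= w)%O = subseq (val w) (val v).
Proof.
move=> bvw; apply/leWP/idP => [[h1 h2 h3]|s].
  have wv : {subset val w <= val v}.
    by move=> a aw; case: (mem_word aw) (aw) => [/h1|->]; [exact|rewrite bvw].
  by rewrite -(all_filterP (introT allP wv)) -[filter _ _]h3 filter_subseq.
have e := subseq_uniqP (uniq_word v) s.
split; [by move=> a _; apply: mem_subseq | by rewrite bvw |].
rewrite /restr -e; apply/esym/all_filterP/allP; exact: mem_subseq s.
Qed.

Lemma letter_le {v w a} : (v <= w)%O -> a \in x -> a \in val w -> a \in val v.
Proof. by case/leWP => h _ _; apply: h. Qed.

Lemma b_le {v w} : (v <= w)%O -> b \in val v -> b \in val w.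
Proof. by case/leWP. Qed.

(** * Full words and completions *)

Definition full w := all [in val w] x.

Lemma fullP {w a} : full w -> a \in x -> a \in val w.
Proof. by move/allP; apply. Qed.

Lemma bot_full : full \bot%O.
Proof. by apply/allP. Qed.

Lemma b_notin_bot : b \notin val (\bot%O : W).
Proof. exact: b_notin_x. Qed.

Lemma full_le {v w} : (v <= w)%O -> full w -> full v.
Proof.
by move=> vw fw; apply/allP => a ax; apply: (letter_le vw ax); apply: fullP.
Qed.

Lemma restr_full {w} : full w -> restr (val w) x = x.
Proof.
move=> fw; rewrite [LHS](subseq_uniqP uniq_x (subseq_word w)).
by apply/all_filterP/allP => a ax; rewrite mem_restr ax /= (fullP fw).
Qed.

Lemma restr_letters {w} : b \notin val w -> restr (val w) x = val w.
Proof.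
move=> bw; apply/all_filterP/allP => a aw; case: (mem_word aw) (aw) => // ->.
by rewrite (negPf bw).
Qed.

Lemma full_b_notin {v} : full v -> b \notin val v -> v = \bot%O.
Proof.
by move=> fv bv; apply: val_inj; rewrite -(restr_letters bv) restr_full.
Qed.

(** A word below [w] is again full; without [b] it is the bottom, and with [b]
    it has the same letters as [w], hence is [w]. *)
Lemma le_full c w : full w -> (c <= w)%O = (c == \bot%O) || (c == w).
Proof.
move=> fw; apply/idP/orP => [cw|[/eqP ->|/eqP ->]]; [|exact: le0x|exact: lexx].
have fc := full_le cw fw.
case bc: (b \in val c); last by left; apply/eqP/full_b_notin; rewrite ?bc.
have bw := b_le cw bc; move: cw; rewrite le_subseq ?bc ?bw // => wc; right.
rewrite -val_eqE; apply/eqP.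
rewrite [RHS](subseq_uniqP (uniq_word c) wc); apply/esym/all_filterP/allP => a ac.
by case: (mem_word ac) => [/(fullP fw)|->].
Qed.

(** [v] is obtained from the full word [c] by deleting letters of [x]. *)
Definition completes c v :=
  [&& full c, (c <= v)%O & (b \in val c) == (b \in val v)].

Lemma completesE c v :
  completes c v = [&& full c, subseq (val v) (val c) & (b \in val c) == (b \in val v)].
Proof.
rewrite /completes; congr andb.
by case: eqP => [e|]; rewrite ?andbF // le_subseq.
Qed.

(** Above a common completion, the order is decided by the letters of [x]: the
    relative order of the letters common to [v] and [w] is the one in [c], which
    contains all of [v] and agrees with [w]. *)
Lemma completes_le {c v w} : completes c v -> (c <= w)%O ->
  (v <= w)%O = [forall i : L, (val i \in val w) ==> (val i \in val v)].
Proof.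
rewrite completesE => /and3P[fc vc /eqP bE] cw.
apply/idP/forallP => [vw i|h].
  by apply/implyP; apply: (letter_le vw); apply: valP.
have vsub := mem_subseq vc.
have [_ _ cwE] := leWP _ _ cw.
apply/leWP; split.
- by move=> a ax aw; have /implyP := h (SeqSub ax); apply.
- by rewrite -bE; apply: b_le.
rewrite {1}(subseq_uniqP (uniq_word c) vc) /restr.
transitivity (restr (restr (val c) (val w)) (val v)).
  by rewrite /restr -!filter_predI; apply: eq_filter => a /=; rewrite andbC.
rewrite cwE restr_comp // => a; rewrite mem_restr => /andP[av aw]; exact: vsub.
Qed.

Lemma subword_subproof {w s} : subseq s (val w) -> s \in shuffle_words x [:: b].
Proof.
move=> sw; apply: word_subproof.
- exact: subseq_uniq sw (uniq_word w).
- by move=> a /(mem_subseq sw) /shuffle_poset_sub.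
apply: subseq_trans (subseq_word w); rewrite subseq_filter filter_all.
exact: subseq_trans (filter_subseq _ _) sw.
Qed.

(** * The Boolean lattice above a full word *)

Definition keep c J : W :=
  SeqSub (subword_subproof (filter_subseq [in b :: [seq val i | i in J]] (val c))).

Definition letters w : {set L} := [set i | val i \in val w].

Lemma b_in_keep c J : (b \in val (keep c J)) = (b \in val c).
Proof. by rewrite mem_filter mem_head. Qed.

Lemma mem_keep c J (i : L) : full c -> (val i \in val (keep c J)) = (i \in J).
Proof.
move=> fc; rewrite mem_filter (fullP fc (valP i)) andbT inE /=.
by rewrite (negPf (mem_neq_b (valP i))) /= mem_image //; apply: val_inj.
Qed.

Lemma keep_completes c J : full c -> completes c (keep c J).
Proof. by move=> fc; rewrite completesE fc filter_subseq b_in_keep eqxx. Qed.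

Lemma letters_keep c J : full c -> letters (keep c J) = J.
Proof. by move=> fc; apply/setP => i; rewrite inE mem_keep. Qed.

Lemma keep_letters {c v} : completes c v -> keep c (letters v) = v.
Proof.
rewrite completesE => /and3P[fc vc /eqP bE]; apply: val_inj => /=.
rewrite [RHS](subseq_uniqP (uniq_word c) vc); apply: eq_in_filter => a ac /=.
rewrite inE; case: (mem_word ac) (ac) => [ax _|->]; last by rewrite eqxx -bE => ->.
rewrite (negPf (mem_neq_b ax)) /=.
by rewrite -[a]/(val (SeqSub ax)) mem_image ?inE //; apply: val_inj.
Qed.

(** [keep c] and [letters] are inverse bijections between sets of letters and
    the words completed by [c], so this is the expansion of a product of
    binomials. *)
Lemma sum_completed {R : comNzRingType} {c} (F G : L -> R) : full c ->
  \sum_(v | completes c v) \prod_i (if val i \in val v then F i else G i)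
  = \prod_i (F i + G i).
Proof.
move=> fc; rewrite bigA_distr (reindex_onto (keep c) letters); last first.
  by move=> v; apply: keep_letters.
apply: eq_big => [J|J _]; first by rewrite keep_completes ?letters_keep ?eqxx.
by apply: eq_bigr => i _; rewrite mem_keep.
Qed.

(** * The Möbius function from the bottom *)

Definition eps c : int := if b \in val c then -1 else 1.

Definition sgn_letters v : int := \prod_(i : L) (if val i \in val v then 1 else -1).

(** For [c <= w] this is an alternating sum over a Boolean interval: it runs
    from [c] to the word obtained from [c] by keeping only the letters of [x]
    that are in [w]. *)
Lemma sum_completed_below {c} w : full c ->
  \sum_(v | (v <= w)%O && completes c v) sgn_letters v
  = ((c <= w)%O && full w)%:R.
Proof.
move=> fc; case cw: (c <= w)%O => /=; last first.
  apply: big1 => v /andP[vw /and3P[_ cv _]].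
  by rewrite (le_trans cv vw) in cw.
transitivity (\prod_(i : L) (1 + (if val i \in val w then 0 else -1)) : int).
  (* The weight 0 for deleting a letter of w kills exactly the words not below w. *)
  rewrite -(sum_completed _ _ fc) [RHS](bigID (fun v => (v <= w)%O)) /=.
  rewrite [X in _ + X]big1 ?addr0; last first.
    move=> v /andP[cv]; rewrite (completes_le cv cw) => /forallPn[i].
    rewrite negb_imply => /andP[iw iv].
    by rewrite (bigD1 i) //= (negPf iv) iw mul0r.
  apply: eq_big => [v|v /andP[vw cv]]; first exact: andbC.
  apply: eq_bigr => i _; case iv: (val i \in val v) => //.
  by case: ifP => // /(letter_le vw (valP i)); rewrite iv.
case fw: (full w).
  by apply: big1 => i _; rewrite (fullP fw (valP i)) addr0.
(* A letter missing from w contributes the factor 1 - 1. *)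
have [a ax aw] := allPn (negbT fw).
by rewrite (bigD1 (SeqSub ax)) //= (negPf aw) subrr mul0r.
Qed.

(** Möbius inversion against the completions; for [w] without [b] the only
    completion is the bottom, so the sum of signs is [1], and for [w] with [b]
    it is minus the number of insertions of [b] below [w]. *)
Lemma mobius_bot w :
  mobius \bot%O w = \sum_(c | completes c w) eps c * sgn_letters w.
Proof.
pose f v := \sum_(c | completes c v) eps c * sgn_letters v.
apply: (mobius_unique f) w => [|w w0]; rewrite /f.
  rewrite (big_pred1 \bot%O) => [|c].
    rewrite /eps (negPf b_notin_bot) mul1r; apply: big1 => i _.
    by rewrite (fullP bot_full (valP i)).
  rewrite /completes lex0 /=; case: (eqVneq c _) => [->|_]; rewrite ?andbF //.
  by rewrite bot_full !eqxx.
rewrite (exchange_big_dep full) => [|v c _ /and3P[] //].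
under eq_bigr => c fc do rewrite -big_distrr sum_completed_below //=.
case fw: (full w); last by apply: big1 => c _; rewrite andbF mulr0n mulr0.
under eq_bigr => c fc do rewrite le_full // andbT.
(* Only the bottom and w are left, with opposite signs. *)
rewrite (bigD1 \bot%O) ?bot_full //= (bigD1 w) ?fw //= big1 => [|c].
  rewrite !eqxx orbT /eps (negPf b_notin_bot).
  case: ifP => [_|/negbT bw]; first by [].
  by rewrite (full_b_notin fw bw) eqxx in w0.
by move=> /andP[/andP[_ /negPf ->] /negPf ->]; rewrite mulr0.
Qed.

(** * Insertions and deletions *)

Lemma insertion_subproof {s1 s2} : x = s1 ++ s2 ->
  s1 ++ b :: s2 \in shuffle_words x [:: b].
Proof.
move=> xE; apply: word_subproof.
- by rewrite -cat1s uniq_catCA -xE uniq_catC; apply: xbU.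
- by move=> a; rewrite xE !(mem_cat, inE) => /or3P[] ->; rewrite ?orbT.
rewrite /restr filter_cat /= (negPf b_notin_x) -filter_cat -xE.
exact: filter_subseq.
Qed.

Lemma insertion_full {s1 s2} (xE : x = s1 ++ s2) :
  full (SeqSub (insertion_subproof xE) : W).
Proof.
by apply/allP => a; rewrite /= {1}xE !(mem_cat, inE) => /orP[->|->]; rewrite ?orbT.
Qed.

Definition insertion (p : 'I_(size x).+1) : W :=
  SeqSub (insertion_subproof (esym (cat_take_drop p x))).

(** The slot is recovered as the index of [b]. *)
Lemma insertion_inj : injective insertion.
Proof.
have idx p : index b (val (insertion p)) = p.
  rewrite /= index_cat; case: ifP => [/mem_take bx|_].
    by case/negP: b_notin_x.
  by rewrite /= eqxx addn0 size_takel // -ltnS.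
by move=> p q /(congr1 (fun w : W => index b (val w))); rewrite !idx => /val_inj.
Qed.

Lemma card_insertions : #|[pred c : W | full c && (c != \bot%O)]| = (size x).+1.
Proof.
rewrite -[RHS]card_ord -(card_codom insertion_inj); apply: eq_card => c.
rewrite inE; apply/andP/codomP => [[fc c0]|[p ->]]; last first.
  split; first exact: insertion_full.
  apply/eqP => e; have /negP[] := b_notin_bot.
  by rewrite -e mem_cat mem_head orbT.
have bc : b \in val c by apply: contraNT c0 => /(full_b_notin fc) ->.
have [u [v cE]] : exists u v : seq T, val c = u ++ b :: v.
  by case/splitPr: bc => u v; exists u, v.
have xE : x = u ++ v.
  have := uniq_word c; rewrite cE cat_uniq /= negb_or.
  move=> /and3P[_ /andP[bu _] /andP[bv _]].
  rewrite -(restr_full fc) cE /restr filter_cat /= (negPf b_notin_x).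
  have inx s : {subset s <= val c} -> b \notin s -> [seq a <- s | a \in x] = s.
    move=> sc bs; apply/all_filterP/allP => a ais.
    by case: (mem_word (sc a ais)) (ais) => // ->; rewrite (negPf bs).
  by rewrite !inx // => a ais; rewrite cE mem_cat ?inE ais ?orbT.
have pm : (size u < (size x).+1)%N by rewrite ltnS xE size_cat leq_addr.
exists (Ordinal pm); apply: val_inj.
by rewrite /= cE xE take_size_cat // drop_size_cat.
Qed.

(** When [w = u b v], the word [uv] embeds in [x], so [x] splits into a part
    containing [u] and a part containing [v], and [b] can be put between. *)
Lemma completion_exists w : exists c, completes c w.
Proof.
case bw: (b \in val w); last first.
  by exists \bot%O; rewrite /completes bot_full le0x (negPf b_notin_bot) bw.
have [u [v wE]] : exists u v : seq T, val w = u ++ b :: v.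
  by case/splitPr: bw => u v; exists u, v.
have : subseq (u ++ v) x.
  apply: subseq_trans (subseq_word w).
  rewrite subseq_filter wE cat_subseq ?subseq_refl ?subseq_cons // andbT.
  apply/allP => a auv; have := uniq_word w.
  rewrite wE -cat1s uniq_catCA /= => /andP[bn _].
  have /mem_word : a \in val w.
    by move: auv; rewrite wE !mem_cat inE => /orP[] ->; rewrite ?orbT.
  by case=> // e; rewrite -e auv in bn.
case/subseq_catP => s1 [s2 [xE s1u s2v]].
exists (SeqSub (insertion_subproof xE)); rewrite completesE insertion_full bw /=.
by rewrite wE cat_subseq //= ?eqxx // mem_cat mem_head orbT.
Qed.

Lemma full_atom {c} : full c -> c != \bot%O -> atom c.
Proof.
move=> fc c0; rewrite /atom /covers lt0x c0 /=; apply/forallP => t.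
apply/negP => /andP[t0 tc]; move: (ltW tc); rewrite le_full // => /orP[] /eqP e.
  by rewrite e ltxx in t0.
by rewrite e ltxx in tc.
Qed.

Lemma bot_completes {v} : b \notin val v -> completes \bot%O v.
Proof. by move=> bv; rewrite /completes bot_full le0x (negPf b_notin_bot) (negPf bv). Qed.

Definition deletion (i : L) : W := keep \bot%O (~: [set i]).

Lemma deletion_b i : b \notin val (deletion i).
Proof. by rewrite b_in_keep b_notin_bot. Qed.

Lemma mem_deletion i (k : L) : (val k \in val (deletion i)) = (k != i).
Proof. by rewrite mem_keep ?bot_full // !inE. Qed.

Lemma deletion_le i w : (deletion i <= w)%O = (val i \notin val w).
Proof.
rewrite (completes_le (bot_completes (deletion_b i)) (le0x _)).
apply/forallP/idP => [/(_ i)|iw k]; rewrite mem_deletion ?eqxx ?implybF //.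
by apply/implyP; apply: contraTneq => ->.
Qed.

Lemma deletion_atom i : atom (deletion i).
Proof.
rewrite /atom /covers lt0x; apply/andP; split.
  by apply/eqP => e; have := mem_deletion i i; rewrite e eqxx (fullP bot_full (valP i)).
apply/forallP => t; apply/negP => /andP[t0 td].
have bt : b \notin val t by apply: contraNN (deletion_b i); apply: (b_le (ltW td)).
case it: (val i \in val t).
  suff ft : full t by rewrite (full_b_notin ft bt) ltxx in t0.
  apply/allP => a ax; have [->|ai] := eqVneq a (val i); first by [].
  apply: (letter_le (ltW td) ax).
  rewrite -[a]/(val (SeqSub ax)) mem_deletion.
  by apply: contraNneq ai => <-.
have dt : (deletion i <= t)%O by rewrite deletion_le it.
by have := lt_le_trans td dt; rewrite ltxx.
Qed.

(** * The generalized rank *)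

Lemma card_letters w : #|letters w| = count [in val w] x.
Proof.
rewrite cardE -(size_map val) -size_filter; apply/perm_size/uniq_perm => [||a].
- by rewrite map_inj_uniq ?enum_uniq //; apply: val_inj.
- by rewrite filter_uniq ?uniq_x.
rewrite mem_filter; apply/mapP/andP => [[i]|[aw ax]].
  by rewrite mem_enum inE => iw ->; split=> //; apply: valP.
by exists (SeqSub ax) => //; rewrite mem_enum inE.
Qed.

Section Chain.

Context {z : nat -> W} (chain_z : deletion_chain z).
Local Notation m := (size x).

Lemma chain_b {i} : (i <= m)%N -> b \notin val (z i).
Proof.
have [[z0 _ _] zd] := chain_z; elim: i => [|i IH] im; first by rewrite z0 b_notin_bot.
have [a _ ->] := zd i im.
by apply: contraNN (IH (ltnW im)); apply: mem_rem.
Qed.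

Lemma chain_size {i} : (i <= m)%N -> size (val (z i)) = (m - i)%N.
Proof.
have [[z0 _ _] zd] := chain_z; elim: i => [|i IH] im; first by rewrite z0 subn0.
by have [a az ->] := zd i im; rewrite size_rem // IH 1?ltnW // subnS.
Qed.

(** An element of the block is below [z i.+1] but not below [z i], so it misses
    the one letter [a] that distinguishes them; so does every word above it.
    Conversely the deletion of [a] belongs to the block. *)
Lemma atom_block_letter {i a} w : (i < m)%N -> a \in val (z i) ->
  val (z i.+1) = rem a (val (z i)) ->
  [exists c in atom_block z i.+1, (c <= w)%O] = (a \notin val w).
Proof.
move=> im az zE.
have memz e : (e \in val (z i.+1)) = (e != a) && (e \in val (z i)).
  by rewrite zE (mem_rem_uniq _ (uniq_word _)).
apply/existsP/idP => [[c]|aw].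
  rewrite inE => /andP[/and3P[_ cz' cz] cw].
  have bc : b \notin val c by apply: contraNN (chain_b im); apply: (b_le cz').
  move: cz; rewrite (completes_le (bot_completes bc) (le0x _)) => /forallPn[j].
  rewrite negb_imply => /andP[jz jc].
  have ja : val j = a.
    apply/eqP; apply: contraNT jc => ja.
    by apply: (letter_le cz' (valP j)); rewrite memz ja.
  rewrite -ja; apply: contraNN jc; exact: (letter_le cw (valP j)).
have ax : a \in x.
  case: (mem_word az) (az) => // ->.
  by rewrite (negPf (chain_b (ltnW im))).
exists (deletion (SeqSub ax)).
by rewrite inE deletion_atom !deletion_le /= aw memz eqxx az.
Qed.

(** Since [z m] is empty, the last block consists of the atoms containing [b],
    which include every insertion of [b] into [x]. *)
Lemma atom_block_last w :
  [exists c in atom_block z m.+1, (c <= w)%O] = (b \in val w).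
Proof.
have [[_ zT _] _] := chain_z.
have zm : val (z m) = [::] by apply/size0nil; rewrite chain_size // subnn.
apply/existsP/idP => [[c]|bw].
  rewrite inE => /andP[/and3P[_ _ cz] cw]; apply: (b_le cw).
  apply: contraNT cz => bc.
  rewrite (completes_le (bot_completes bc) (le0x _)); apply/forallP => j.
  by rewrite zm.
have [c /and3P[fc cw /eqP bE]] := completion_exists w.
have bc : b \in val c by rewrite bE.
exists c; rewrite inE zT lex1 cw full_atom //=; last first.
  by apply: contraTneq bc => ->; apply: b_notin_bot.
rewrite andbT; apply/negP => /b_le /(_ bc); by rewrite zm.
Qed.

(** Each letter of [x] is deleted at exactly one step of the chain, so the first
    [m] blocks count the letters of [x] missing from [w]. *)
Lemma gen_rankE w :
  gen_rank m.+1 z w = (count (predC [in val w]) x + (b \in val w))%N.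
Proof.
(* After k steps, the letters still in z k are those not yet accounted for. *)
have step k : (k <= m)%N ->
    (\sum_(1 <= i < k.+1 | [exists c in atom_block z i, (c <= w)%O]) 1
      + count (predC [in val w]) (val (z k)) = count (predC [in val w]) x)%N.
  have [[z0 _ _] zd] := chain_z; elim: k => [|k IH] km.
    by rewrite big_geq // z0.
  have [a az zE] := zd k km.
  rewrite -(IH (ltnW km)) big_mkcond big_nat_recr //= -big_mkcond /=.
  rewrite (atom_block_letter _ km az zE) zE count_rem az /=.
  rewrite -addnA; congr (_ + _)%N.
  case aw: (a \in val w); rewrite ?subn0 //= add1n subn1 prednK // -has_count.
  by apply/hasP; exists a; rewrite //= aw.
rewrite /gen_rank big_mkcond big_nat_recr //= -big_mkcond atom_block_last.
have := step m (leqnn m).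
rewrite (size0nil (_ : size (val (z m)) = 0%N)) ?chain_size ?subnn // addn0 => ->.
by case: (b \in _).
Qed.

Lemma corankE w :
  (m.+1 - gen_rank m.+1 z w)%N = (#|letters w| + (b \notin val w))%N.
Proof.
rewrite gen_rankE card_letters -[in LHS](count_predC [in val w] x).
by case: (b \in _) => /=; rewrite ?addn0 ?addn1 ?subSS ?subSn ?leq_addl ?addnK.
Qed.

End Chain.

(** * The characteristic polynomial *)

(** A kept letter of [x] carries the weight [X] and a deleted one the weight
    [-1], whence a factor [X - 1] per letter. *)
Lemma sum_completed_monomials {c} : full c ->
  \sum_(v | completes c v) sgn_letters v *: 'X^(#|letters v| + (b \notin val v))
  = ('X - 1) ^+ size x * 'X^(b \notin val c) :> {poly int}.
Proof.
move=> fc; rewrite -(card_seq_sub uniq_x) -prodr_const.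
rewrite -(sum_completed (fun=> 'X) (fun=> -1) fc) mulr_suml.
apply: eq_bigr => v /and3P[_ _ /eqP ->].
rewrite exprD scalerAl; congr (_ * _).
rewrite -mul_polyC rmorph_prod /= -prodr_const [X in _ * X]big_mkcond -big_split /=.
apply: eq_bigr => i _; rewrite inE.
by case: ifP => _; rewrite ?rmorphN rmorph1 ?mul1r ?mulr1.
Qed.

Theorem char_poly_one_letter {z : nat -> W} : deletion_chain z ->
  char_poly_chain (size x).+1 z = ('X - 1) ^+ size x * ('X - (size x)%:R - 1).
Proof.
move=> chain_z; rewrite /char_poly_chain.
transitivity (\sum_(c | full c)
    eps c *: (('X - 1) ^+ size x * 'X^(b \notin val c)) : {poly int}).
  under eq_bigr => v _ do rewrite mobius_bot (corankE chain_z) scaler_suml.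
  rewrite (exchange_big_dep full) => [|v c _ /and3P[] //].
  apply: eq_bigr => c fc; rewrite -(sum_completed_monomials fc) scaler_sumr.
  by apply: eq_bigr => v _; rewrite scalerA.
rewrite (bigD1 \bot%O) ?bot_full //= /eps (negPf b_notin_bot) scale1r expr1.
rewrite (eq_bigr (fun=> - ('X - 1) ^+ size x)) => [|c /andP[fc c0]].
  rewrite sumr_const card_insertions mulNrn -[_ *+ _.+1]mulr_natr -mulrBr.
  by rewrite -natr1 opprD addrA.
case: ifP => [_|/negbT /(full_b_notin fc) e]; last by rewrite e eqxx in c0.
by rewrite expr0 mulr1 scaleN1r.
Qed.

End OneLetter.

Theorem corollary7p1 (m : nat) (T : choiceType) (x y : seq T)
  (xyU : uniq (x ++ y)) (size_x : size x = m) (size_y : size y = 1%N)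
  (z : nat -> shuffle_poset xyU) (chain_z : deletion_chain z) :
  char_poly_chain m.+1 z = ('X - 1) ^+ m * ('X - m%:R - 1) :> {poly int}.
Proof.
subst m; case: y size_y xyU z chain_z => [|b []] // _ xbU z.
exact: char_poly_one_letter.
Qed.
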